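(* Let $(x_k)_{k\ge0}$ be the iterates of APPROX (as defined in the context) applied to the minimization of $F=f+\psi$ on $\mathbb{R}^n$, and let $k\ge1$. Let $$\mathring x_k=\frac{1}{\sum_{i=0}^{k-1}\frac{\gamma_k^i}{\theta_{i-1}^2}+\frac{1}{\theta_0\theta_{k-1}}-\frac{1-\theta_0}{\theta_0^2}}\left(\sum_{i=0}^{k-1}\frac{\gamma_k^i}{\theta_{i-1}^2}x_i+\left(\frac{1}{\theta_0\theta_{k-1}}-\frac{1-\theta_0}{\theta_0^2}\right)x_k\right),$$ which is a convex combination of $x_0,\dots,x_k$. Let $\sigma\in[0,1]$ and $\bar x_k=\sigma x_k+(1-\sigma)\mathring x_k$. Define $$\Delta(x)=\frac{1-\theta_0}{\theta_0^2}(F(x)-F(x_* ))+\frac{1}{2\theta_0^2}\|x-x_*\|_v^2,$$ $$m_k(\mu)=\frac{\mu\theta_0^2}{1+\mu(1-\theta_0)}\left(\sum_{i=0}^{k-1}\frac{\gamma_k^i}{\theta_{i-1}^2}+\frac{1}{\theta_0\theta_{k-1}}-\frac{1-\theta_0}{\theta_0^2}\right).$$ Then $$\mathbf{E}[\Delta(\bar x_k)]\le\max\left(\sigma,\,1-\sigma m_k(\mu_F(v))\right)\Delta(x_0).$$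
   Context: Problem: $f:\mathbb{R}^n\to\mathbb{R}$ is convex and differentiable; $\psi(x)=\sum_{i=1}^n\psi^i(x^i)$ where each $\psi^i:\mathbb{R}\to\mathbb{R}\cup\{+\infty\}$ is closed and convex; $F=f+\psi$; $x_*$ is a minimizer of $F$; $\operatorname{dom}\psi=\{x:\psi(x)<+\infty\}$. For a vector $v$ with positive entries, $\|x\|_v^2=\sum_{i=1}^n v_i(x^i)^2$. Strong convexity assumption: $\mu_F(v)>0$ is a constant such that $F(x)\ge F(x_* )+\frac{\mu_F(v)}{2}\|x-x_*\|_v^2$ for all $x\in\mathbb{R}^n$. Sampling: $\hat S$ is a random subset of $\{1,\dots,n\}$ with $\mathbf{P}(i\in\hat S)=\mathbf{P}(j\in\hat S)$ for all $i,j$, and $\tau=\mathbf{E}[|\hat S|]>0$. ESO assumption: for all $x,h\in\mathbb{R}^n$, $\mathbf{E}[f(x+h_{[\hat S]})]\le f(x)+\frac{\tau}{n}\left(\langle\nabla f(x),h\rangle+\frac12\|h\|_v^2\right)$, where $h_{[S]}=\sum_{i\in S}h^ie_i$ and $e_i$ is the $i$th standard basis vector. APPROX: choose $x_0\in\operatorname{dom}\psi$, $z_0=x_0$, $\theta_0=\tau/n$. For $k\ge0$: $y_k=(1-\theta_k)x_k+\theta_kz_k$; draw $S_k\sim\hat S$ (independently of the past); for $i\in S_k$ set $z_{k+1}^i=\arg\min_{z\in\mathbb{R}}\{\langle\nabla_if(y_k),z-y_k^i\rangle+\frac{\theta_knv_i}{2\tau}|z-z_k^i|^2+\psi^i(z)\}$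 ($\nabla_i f$ is the $i$th partial derivative), and $z_{k+1}^i=z_k^i$ for $i\notin S_k$; $x_{k+1}=y_k+\frac{n}{\tau}\theta_k(z_{k+1}-z_k)$; $\theta_{k+1}=\frac{\sqrt{\theta_k^4+4\theta_k^2}-\theta_k^2}{2}$. Coefficients: $\frac{1}{\theta_{-1}^2}:=\frac{1-\theta_0}{\theta_0^2}$; $\gamma_0^0=1$, $\gamma_1^0=0$, $\gamma_1^1=1$, and for $k\ge1$: $\gamma_{k+1}^i=(1-\theta_k)\gamma_k^i$ for $i=0,\dots,k-1$; $\gamma_{k+1}^k=\theta_k(1-\frac n\tau\theta_{k-1})+\frac n\tau(\theta_{k-1}-\theta_k)$; $\gamma_{k+1}^{k+1}=\frac n\tau\theta_k$. *)

(* Defs.v *)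
From HB Require Import structures.
From mathcomp Require Export all_boot all_order all_algebra.
From mathcomp Require Export all_classical all_reals all_analysis.

Set Implicit Arguments.
Unset Strict Implicit.
Unset Printing Implicit Defensive.

Export numFieldNormedType.Exports.
Import Order.TTheory GRing.Theory Num.Theory.

Local Open Scope classical_set_scope.
Local Open Scope ring_scope.

(* Random subsets of a finite type are random variables for the discrete
   sigma-algebra on {set I}. *)
HB.instance Definition _ (I : finType) := isPointed.Build {set I} (@finset.set0 I).
HB.instance Definition _ (I : finType) :=
  @isMeasurable.Build default_measure_display {set I}
    discrete_measurable discrete_measurable0
    discrete_measurableC discrete_measurableU.

Definition mutually_independent (R : realType) (d d' : measure_display)
    (T : measurableType d) (T' : measurableType d') (P : probability T R)
    (X : nat -> {RV P >-> T'}) : Prop :=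
  forall (J : seq nat) (B : nat -> set T'), uniq J ->
    (forall j, measurable (B j)) ->
    P (\bigcap_(j in [set` J]) (X j @^-1` B j)) =
      (\prod_(j <- J) P (X j @^-1` B j))%E.

Definition same_distribution (R : realType) (d d' : measure_display)
    (T : measurableType d) (T' : measurableType d') (P : probability T R)
    (X Y : {RV P >-> T'}) : Prop :=
  forall B : set T', measurable B -> distribution P X B = distribution P Y B.

Definition extended_convex (R : realType) (g : R -> \bar R) : Prop :=
  forall s t a : R, 0 <= a <= 1 ->
    (g (a * s + (1 - a) * t)%R <= a%:E * g s + (1 - a)%:E * g t)%E.

Definition closed_function (R : realType) (g : R -> \bar R) : Prop :=
  closed [set p : R * R | (g p.1 <= p.2%:E)%E].

Definition is_argmin (T : Type) (R : realType) (g : T -> \bar R) (a : T) :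
  Prop := forall b : T, (g a <= g b)%E.

Definition wnormsq (R : realType) (n : nat) (v : 'I_n -> R) (x : 'rV[R]_n) : R :=
  \sum_(i < n) v i * x ord0 i ^+ 2.

Definition partial (R : realType) (n : nat) (f : 'rV[R]_n -> R) (i : 'I_n)
  (x : 'rV[R]_n) : R := 'D_(delta_mx ord0 i) f x.

Definition restrict_vec (R : realType) (n : nat) (h : 'rV[R]_n)
  (S : {set 'I_n}) : 'rV[R]_n := \sum_(i in S) h ord0 i *: delta_mx ord0 i.

Definition separable (R : realType) (n : nat) (psi : 'I_n -> R -> \bar R)
  (x : 'rV[R]_n) : \bar R := (\sum_(i < n) psi i (x ord0 i))%E.

Definition effective_domain (R : realType) (T : Type) (g : T -> \bar R) : set T :=
  [set x | (g x < +oo)%E].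

Definition composite (R : realType) (n : nat) (f : 'rV[R]_n -> R)
    (psi : 'I_n -> R -> \bar R) (x : 'rV[R]_n) : \bar R :=
  ((f x)%:E + separable psi x)%E.

Definition eso (R : realType) (d : measure_display) (T : measurableType d)
    (P : probability T R) (n : nat) (f : 'rV[R]_n -> R)
    (Shat : {RV P >-> {set 'I_n}}) (tau : R) (v : 'I_n -> R) : Prop :=
  forall x h : 'rV[R]_n,
    ('E_P[fun w => f (x + restrict_vec h (Shat w))%R] <=
     (f x + tau / n%:R *
        (\sum_(i < n) partial f i x * h ord0 i + 2^-1 * wnormsq v h))%:E)%E.

Fixpoint theta (R : realType) (theta0 : R) (k : nat) : R :=
  if k is k'.+1 then
    let t := theta theta0 k' in
    (Num.sqrt (t ^+ 4 + 4 * t ^+ 2) - t ^+ 2) / 2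
  else theta0.

(* [inv_theta_sq theta0 i] is 1 / theta_{i-1}^2, including the convention
   1 / theta_{-1}^2 = (1 - theta0) / theta0^2. *)
Definition inv_theta_sq (R : realType) (theta0 : R) (i : nat) : R :=
  if i is i'.+1 then (theta theta0 i' ^+ 2)^-1
  else (1 - theta0) / theta0 ^+ 2.

(* [gamma n tau k i] is gamma_k^i, extended by 0 for i > k. *)
Fixpoint gamma (R : realType) (n : nat) (tau : R) (k : nat) : nat -> R :=
  let th := theta (tau / n%:R) in
  match k with
  | 0%N => fun i => (i == 0%N)%:R
  | 1%N => fun i => (i == 1%N)%:R
  | (k'.+1 as m).+1 => fun i =>
      if (i < m)%N then (1 - th m) * gamma n tau m i
      else if i == m then
        th m * (1 - n%:R / tau * th k') + n%:R / tau * (th k' - th m)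
      else if i == m.+1 then n%:R / tau * th m
      else 0
  end.

Definition coord_objective (R : realType) (n : nat) (f : 'rV[R]_n -> R)
    (psi : 'I_n -> R -> \bar R) (tau : R) (v : 'I_n -> R) (theta_k : R)
    (y z : 'rV[R]_n) (i : 'I_n) (t : R) : \bar R :=
  ((partial f i y * (t - y ord0 i)
    + theta_k * n%:R * v i / (2 * tau) * `|t - z ord0 i| ^+ 2)%:E
   + psi i t)%E.

Record approx_run (R : realType) (n : nat) (f : 'rV[R]_n -> R)
    (psi : 'I_n -> R -> \bar R) (tau : R) (v : 'I_n -> R) (x0 : 'rV[R]_n)
    (s : nat -> {set 'I_n}) (x y z : nat -> 'rV[R]_n) : Prop := ApproxRun {
  approx_x0 : x 0%N = x0 ;
  approx_z0 : z 0%N = x0 ;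
  approx_y : forall k, let th := theta (tau / n%:R) k in
    y k = (1 - th) *: x k + th *: z k ;
  approx_z_in : forall k i, i \in s k ->
    is_argmin
      (coord_objective f psi tau v (theta (tau / n%:R) k) (y k) (z k) i)
      (z k.+1 ord0 i) ;
  approx_z_notin : forall k i, i \notin s k -> z k.+1 ord0 i = z k ord0 i ;
  approx_x : forall k,
    x k.+1 = y k + (n%:R / tau * theta (tau / n%:R) k) *: (z k.+1 - z k)
}.

Definition last_weight (R : realType) (theta0 : R) (k : nat) : R :=
  (theta0 * theta theta0 k.-1)^-1 - (1 - theta0) / theta0 ^+ 2.

Definition total_weight (R : realType) (n : nat) (tau : R) (k : nat) : R :=
  \sum_(i < k) gamma n tau k i * inv_theta_sq (tau / n%:R) i
  + last_weight (tau / n%:R) k.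

Definition ring_point (R : realType) (n : nat) (tau : R) (k : nat)
    (x : nat -> 'rV[R]_n) : 'rV[R]_n :=
  (total_weight n tau k)^-1 *:
    (\sum_(i < k) (gamma n tau k i * inv_theta_sq (tau / n%:R) i) *: x i
     + last_weight (tau / n%:R) k *: x k).

Definition bar_point (R : realType) (n : nat) (tau sigma : R) (k : nat)
    (x : nat -> 'rV[R]_n) : 'rV[R]_n :=
  sigma *: x k + (1 - sigma) *: ring_point tau k x.

Definition Delta (R : realType) (n : nat) (F : 'rV[R]_n -> \bar R)
    (xstar : 'rV[R]_n) (theta0 : R) (v : 'I_n -> R) (x : 'rV[R]_n) : \bar R :=
  (((1 - theta0) / theta0 ^+ 2)%:E * (F x - F xstar)
   + ((2 * theta0 ^+ 2)^-1 * wnormsq v (x - xstar))%:E)%E.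

Definition m_coef (R : realType) (n : nat) (tau : R) (k : nat) (mu : R) : R :=
  let theta0 := tau / n%:R in
  mu * theta0 ^+ 2 / (1 + mu * (1 - theta0)) * total_weight n tau k.

(* Main.v *)
Require Import Defs.
From mathcomp Require Import all_boot all_order all_algebra.
From mathcomp Require Import all_classical all_reals all_analysis.
From mathcomp Require Import ring lra.
Import Order.TTheory GRing.Theory Num.Theory.
Local Open Scope classical_set_scope.
Local Open Scope ring_scope.

(** Write [Fmin] for the minimum, [t0 = tau / n], and let
    [Fhat_k = f(x_k) + \sum_i gamma_k^i psi(z_i)], which dominates [F(x_k)]
    because [x_k = \sum_i gamma_k^i z_i] is a convex combination.  The ESO
    inequality, the gradient inequality for [f] and the three-point inequality
    for the proximal steps show that
      [(Fhat_k - Fmin) / theta_{k-1}^2 + |z_k - xstar|_v^2 / (2 t0^2)]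
    decreases in expectation; it starts at [Delta(x_0)].  Averaging the bounds
    on [|z_i - xstar|_v^2] with the weights [gamma_k^i] gives
      [E Delta(x_k) <= Delta(x_0) - \sum_i w_i E(F(x_i) - Fmin)],
    where the [w_i >= 0] are the unnormalised weights of the ring point.  By
    convexity the last sum is at least [total_weight * E(F(ring) - Fmin)], and
    strong convexity bounds this below by [m_k(mu) E Delta(ring)].  Together
    with [E Delta(ring) <= Delta(x_0)] and the convexity of [Delta] this yields
    the claim.

    No measurability of the iterates is assumed.  Since the coordinate argmins
    are unique, [x_k] is a function of the finite-valued history
    [S_0, ..., S_(k-1)], so every expectation is a finite sum over histories,
    weighted by a product of probabilities; conditioning on the past at step
    [j] amounts to resampling coordinate [j] of the history. *)

Set Implicit Arguments.
Unset Strict Implicit.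
Unset Printing Implicit Defensive.

(** * Convexity on a domain and Jensen's inequality *)

(** Convexity of the domain is bundled with the inequality, so that a single application of [jensen]
    yields both membership in [D] and the bound. This suits extended-valued functions replaced by
    their real values on their domain. *)
Definition convex_on (R : realFieldType) (V : lmodType R) (D : V -> Prop)
    (g : V -> R) : Prop :=
  forall a x y, 0 <= a <= 1 -> D x -> D y ->
    D (a *: x + (1 - a) *: y) /\
    g (a *: x + (1 - a) *: y) <= a * g x + (1 - a) * g y.

(** Induction on the number of points: the last point is split off and the other weights are divided
    by their sum [s]. If [s = 0] these weights all vanish and only the last point remains. *)
Lemma jensen (R : realFieldType) (V : lmodType R) (D : V -> Prop) (g : V -> R)
    (m : nat) (c : 'I_m -> R) (p : 'I_m -> V) :
  convex_on D g -> (forall i, 0 <= c i) -> \sum_i c i = 1 ->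
  (forall i, D (p i)) ->
  D (\sum_i c i *: p i) /\ g (\sum_i c i *: p i) <= \sum_i c i * g (p i).
Proof.
move=> Dg; elim: m c p => [|m IHm] c p c0.
  by rewrite big_ord0 => /esym/eqP; rewrite oner_eq0.
rewrite !big_ord_recr /= => c1 Dp.
set cm := c ord_max in c1 *.
set s := \sum_(i < m) c (widen_ord (leqnSn m) i) in c1.
have s0 : 0 <= s by apply: sumr_ge0.
have cmE : cm = 1 - s by rewrite -c1; ring.
have cm0 : 0 <= cm by apply: c0.
have [sE|sn0] := eqVneq s 0.
  have ci0 i : c (widen_ord (leqnSn m) i) = 0.
    apply/eqP; rewrite eq_le c0 andbT -sE /s (bigD1 i) //= lerDl.
    exact: sumr_ge0.
  rewrite big1; last by move=> i _; rewrite ci0 scale0r.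
  rewrite (big1 _ _ (fun i => c (widen_ord _ i) * _)); last first.
    by move=> i _; rewrite ci0 mul0r.
  by rewrite cmE sE subr0 !add0r scale1r mul1r.
have sgt0 : 0 < s by rewrite lt_neqAle eq_sym sn0.
have [||i|Dq gq] := IHm (fun i => c (widen_ord (leqnSn m) i) / s)
    (fun i => p (widen_ord (leqnSn m) i)).
- by move=> i; rewrite divr_ge0.
- by rewrite -mulr_suml divff.
- exact: Dp.
set q := \sum_i _ in Dq gq.
have qE : \sum_(i < m) c (widen_ord (leqnSn m) i) *: p (widen_ord (leqnSn m) i)
    = s *: q.
  rewrite scaler_sumr; apply: eq_bigr => i _.
  by rewrite scalerA mulrCA divff// mulr1.
have gE : \sum_(i < m) c (widen_ord (leqnSn m) i) * g (p (widen_ord (leqnSn m) i))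
    = s * \sum_(i < m) c (widen_ord (leqnSn m) i) / s * g (p (widen_ord (leqnSn m) i)).
  rewrite mulr_sumr; apply: eq_bigr => i _.
  by rewrite mulrA mulrCA divff// mulr1.
have s01 : 0 <= s <= 1 by rewrite s0 /=; lra.
have [D1 g1] := Dg s q (p ord_max) s01 Dq (Dp _).
rewrite qE gE cmE; split=> //; apply: le_trans g1 _.
by rewrite lerD2r ler_wpM2l.
Qed.

(** * The coefficients theta and gamma *)

Lemma theta_gt0 (R : realType) (t0 : R) k : 0 < t0 -> 0 < theta t0 k.
Proof.
move=> t00; elim: k => //= k IHk; set t := theta t0 k in IHk *.
rewrite divr_gt0// subr_gt0.
have t2 : 0 <= t ^+ 2 by rewrite exprn_ge0 ?ltW.
have e : t ^+ 2 = Num.sqrt (t ^+ 4).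
  by rewrite -[LHS]ger0_norm// -sqrtr_sqr -exprM.
rewrite [ltLHS]e.
have t20 : 0 < 4 * t ^+ 2 by rewrite mulr_gt0 ?exprn_gt0.
by rewrite ltr_sqrt ?ltrDl// addr_gt0// exprn_gt0.
Qed.

(** [theta t0 k.+1] is the positive root [u] of [u^2 + t^2 u - t^2 = 0], where [t = theta t0 k]. *)
Lemma theta_sqS (R : realType) (t0 : R) k : 0 < t0 ->
  theta t0 k.+1 ^+ 2 = (1 - theta t0 k.+1) * theta t0 k ^+ 2.
Proof.
move=> t00 /=; have := theta_gt0 k t00; set t := theta t0 k => tgt0.
set s := Num.sqrt _.
have s2 : s ^+ 2 = t ^+ 4 + 4 * t ^+ 2.
  by rewrite sqr_sqrtr// addr_ge0 ?mulr_ge0 ?exprn_ge0// ltW.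
have -> : ((s - t ^+ 2) / 2) ^+ 2 = (s ^+ 2 - 2 * s * t ^+ 2 + t ^+ 4) / 4 by field.
by rewrite s2; field.
Qed.

Lemma theta_le (R : realType) (t0 : R) k : 0 < t0 ->
  theta t0 k.+1 <= theta t0 k.
Proof.
move=> t00; have t1 := theta_gt0 k t00; have u1 := theta_gt0 k.+1 t00.
rewrite -ler_sqr ?nnegrE ?(ltW t1) ?(ltW u1)// theta_sqS// ler_piMl//.
  by rewrite exprn_ge0 ?ltW.
by lra.
Qed.

Lemma theta_le0 (R : realType) (t0 : R) k : 0 < t0 -> theta t0 k <= t0.
Proof.
by move=> t00; elim: k => // k; apply: le_trans; exact: theta_le.
Qed.

(** The recursion [theta_sqS] divided by both squares. The convention for [1 / theta_{-1}^2] is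
    exactly this formula at [k = 0]. *)
Lemma inv_theta_sqE (R : realType) (t0 : R) k : 0 < t0 ->
  inv_theta_sq t0 k = (1 - theta t0 k) / theta t0 k ^+ 2.
Proof.
case: k => // k t00; rewrite /inv_theta_sq.
have t1 := theta_gt0 k t00; have u1 := theta_gt0 k.+1 t00.
have e := theta_sqS k t00.
(* Positivity of the square forces its factor [1 - theta t0 k.+1] to be nonzero, which allows the
   cancellation below. *)
have : theta t0 k.+1 ^+ 2 != 0 by rewrite gt_eqF// exprn_gt0.
rewrite e mulf_eq0 negb_or => /andP[h _].
by rewrite [in RHS](invfM (1 - _)) mulrA divff// mul1r.
Qed.

Lemma inv_theta_sq_ge0 (R : realType) (t0 : R) k : 0 < t0 <= 1 ->
  0 <= inv_theta_sq t0 k.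
Proof.
move=> /andP[t00 t01]; rewrite inv_theta_sqE// divr_ge0//.
  by rewrite subr_ge0 (le_trans (theta_le0 k t00)).
by rewrite exprn_ge0 ?ltW ?theta_gt0.
Qed.

Section gamma_lemmas.
Variables (R : realType) (n : nat) (tau : R).
Hypothesis th0 : 0 < tau / n%:R <= 1.
Let t0 := tau / n%:R.
Let t00 : 0 < t0. Proof. by case/andP: th0. Qed.
Let invt0 : n%:R / tau = t0^-1. Proof. by rewrite invfM invrK mulrC. Qed.

Lemma gammaSS k i : gamma n tau k.+2 i =
  if (i < k.+1)%N then (1 - theta t0 k.+1) * gamma n tau k.+1 i
  else if i == k.+1 then theta t0 k.+1 * (1 - n%:R / tau * theta t0 k)
    + n%:R / tau * (theta t0 k - theta t0 k.+1)
  else if i == k.+2 then n%:R / tau * theta t0 k.+1 else 0.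
Proof. by []. Qed.

Lemma gamma_diag k : gamma n tau k.+1 k.+1 = n%:R / tau * theta t0 k.
Proof.
case: k => [|k]; first by rewrite /= invt0 mulVf// gt_eqF.
by rewrite gammaSS ltnNge leqnSn /= gtn_eqF// eqxx.
Qed.

(** The recursion of [gamma] copies the update of [x]. Stating it for an arbitrary sequence in a
    module covers the iterates [z], the values of psi at them, and the constant 1. *)
Lemma gamma_sumS (V : lmodType R) (a : nat -> V) k :
  \sum_(i < k.+2) gamma n tau k.+1 i *: a i =
  (1 - theta t0 k) *: (\sum_(i < k.+1) gamma n tau k i *: a i)
  + theta t0 k *: a k + (n%:R / tau * theta t0 k) *: (a k.+1 - a k).
Proof.
case: k => [|k].
  (* For [k = 0] the factor [n / tau * theta t0 0] equals 1, so all terms except [a 1] cancel. *)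
  rewrite !big_ord_recr !big_ord0 /= !add0r !scale0r add0r !scale1r.
  rewrite invt0 mulVf ?gt_eqF// scale1r -scalerDl subrK scale1r.
  by rewrite addrC subrK.
rewrite [in LHS]big_ord_recr [in LHS]big_ord_recr [in RHS]big_ord_recr.
rewrite [nat_of_ord ord_max]/= !gamma_diag.
rewrite [X in X + _ + _ = _](_ : _ =
   (1 - theta t0 k.+1) *: \sum_(i < k.+1) gamma n tau k.+1 i *: a i); last first.
  rewrite scaler_sumr; apply: eq_bigr => i _.
  by rewrite [nat_of_ord _]/= gammaSS ltn_ord scalerA.
rewrite [nat_of_ord _]/= gammaSS ltnn eqxx [in RHS]scalerDr -!addrA; congr +%R.
rewrite scalerBr scalerA addrA -scalerDl.
rewrite [in RHS]addrCA addrC; congr +%R; rewrite -scaleNr -scalerDl.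
by congr (_ *: _); ring.
Qed.

(** The only delicate entry is the middle one: its first term is nonnegative since [theta] never
    exceeds [tau / n], its second since [theta] is nonincreasing. *)
Lemma gamma_ge0 k i : 0 <= gamma n tau k i.
Proof.
elim: k i => [|k IHk] i; first by rewrite /= ler0n.
case: k IHk => [|k] IHk; first by rewrite /= ler0n.
have nt0 : 0 <= n%:R / tau by rewrite invt0 invr_ge0 ltW.
have u0 := theta_gt0 k.+1 t00; have ut := theta_le k t00.
have u1 : theta t0 k.+1 <= 1.
  by apply: le_trans (theta_le0 _ t00) _; case/andP: th0.
have tk := theta_gt0 k t00; have tk0 := theta_le0 k t00.
rewrite gammaSS; set u := theta t0 k.+1 in u0 ut u1 *.
case: ifP => _; first by rewrite mulr_ge0 ?subr_ge0 ?IHk.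
case: ifP => _; last by case: ifP => // _; rewrite mulr_ge0// ltW.
have u0' := ltW u0; have n0 : 0 <= t0^-1 by rewrite invr_ge0 ltW.
rewrite invt0; apply: addr_ge0; apply: mulr_ge0 => //; rewrite subr_ge0//.
by rewrite mulrC ler_pdivrMr// mul1r.
Qed.

Lemma gamma_sumSr (a : nat -> R) k :
  \sum_(i < k.+2) gamma n tau k.+1 i * a i =
  (1 - theta t0 k) * (\sum_(i < k.+1) gamma n tau k i * a i)
  + theta t0 k * a k + (n%:R / tau * theta t0 k) * (a k.+1 - a k).
Proof. exact: (gamma_sumS (a : nat -> R^o)). Qed.

Lemma gamma_sum1 k : \sum_(i < k.+1) gamma n tau k i = 1.
Proof.
elim: k => [|k IHk]; first by rewrite big_ord_recr big_ord0 /= add0r.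
have := gamma_sumSr (fun=> 1) k.
rewrite subrr mulr0 addr0 -!mulr_suml !mulr1 => ->.
by rewrite IHk mulr1 subrK.
Qed.

(** After factoring out [1 / t0], this is [1 / theta >= 1 / t0 > (1 - t0) / t0]. *)
Lemma last_weight_gt0 k : 0 < last_weight t0 k.
Proof.
rewrite /last_weight invfM subr_gt0.
have t1 := theta_gt0 k.-1 t00; have t2 := theta_le0 k.-1 t00.
have -> : (1 - t0) / t0 ^+ 2 = t0^-1 * ((1 - t0) / t0) by field; rewrite gt_eqF.
rewrite ltr_pM2l ?invr_gt0//; apply: (@lt_le_trans _ _ t0^-1).
  by rewrite ltr_pdivrMr// mulVf ?gt_eqF//; lra.
by rewrite lef_pV2 ?posrE.
Qed.

(** Merging the last weight with the others makes the ring point one sum over ['I_k.+1], to which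
    [jensen] applies. *)
Definition ring_weight k (i : nat) : R :=
  if (i < k)%N then gamma n tau k i * inv_theta_sq t0 i else last_weight t0 k.

Lemma ring_weight_ge0 k i : 0 <= ring_weight k i.
Proof.
rewrite /ring_weight; case: ifP => _; last exact: ltW (last_weight_gt0 k).
by rewrite mulr_ge0 ?gamma_ge0 ?inv_theta_sq_ge0.
Qed.

Lemma total_weightE k : total_weight n tau k = \sum_(i < k.+1) ring_weight k i.
Proof.
rewrite big_ord_recr /= /ring_weight ltnn; congr (_ + _).
by apply: eq_bigr => i _; rewrite ltn_ord.
Qed.

Lemma total_weight_gt0 k : 0 < total_weight n tau k.
Proof.
rewrite /total_weight ltr_wpDl ?last_weight_gt0// sumr_ge0// => i _.
by rewrite mulr_ge0 ?gamma_ge0 ?inv_theta_sq_ge0.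
Qed.

Lemma ring_pointE k (x : nat -> 'rV[R]_n) : ring_point tau k x =
  \sum_(i < k.+1) (ring_weight k i / total_weight n tau k) *: x i.
Proof.
rewrite /ring_point big_ord_recr /= {2}/ring_weight ltnn scalerDr scalerA.
rewrite [(total_weight _ _ _)^-1 * last_weight _ _]mulrC scaler_sumr.
by congr +%R; apply: eq_bigr => i _; rewrite scalerA /ring_weight ltn_ord mulrC.
Qed.

End gamma_lemmas.

(** * Convex analysis *)

Lemma convex_functionP (R : realType) (V : lmodType R) (f : V -> R) :
  convex_function setT f -> convex_on (fun=> True) f.
Proof.
move=> cf a x y /andP[a0 a1] _ _; split=> //.
by have := cf (Itv01 a0 a1) x y (in_setT _) (in_setT _).
Qed.

Lemma derive_partial (R : realType) (n : nat) (f : 'rV[R]_n -> R)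
    (y h : 'rV[R]_n) : differentiable f y ->
  'D_h f y = \sum_i partial f i y * h ord0 i.
Proof.
move=> df; rewrite deriveE// [in LHS](row_sum_delta h) linear_sum.
apply: eq_bigr => i _; rewrite linearZ /= /partial deriveE//.
by rewrite [LHS]mulrC.
Qed.

(** By convexity the difference quotient at [y] in direction [x - y] is at most [f x - f y] for
    every step in [(0, 1]]; the bound passes to the limit from the right. *)
Lemma convex_ge_tangent (R : realType) (n : nat) (f : 'rV[R]_n -> R)
    (x y : 'rV[R]_n) : convex_on (fun=> True) f -> differentiable f y ->
  f y + \sum_i partial f i y * (x - y) ord0 i <= f x.
Proof.
move=> cf df; rewrite -derive_partial// addrC -lerBrDr.
have dv : derivable f y (x - y) by exact: diff_derivable.
have cv := cvg_dnbhs_at_right dv.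
rewrite /derive -(cvg_lim _ cv)//; apply: limr_le; first by apply/cvg_ex; eexists; exact: cv.
near=> t.
have t0 : 0 < t by near: t; exact: nbhs_right_gt.
have t1 : t <= 1 by near: t; exact: nbhs_right_le.
have t01 : 0 <= t <= 1 by rewrite ltW.
have [_] := cf t x y t01 I I.
have -> : t *: x + (1 - t) *: y = t *: (x - y) + y.
  by rewrite scalerBr scalerBl scale1r addrA addrAC.
move=> h; rewrite /= -[_ *: _]/(_ * _) mulrC ler_pdivrMr//.
by lra.
Unshelve. all: by end_near.
Qed.

(** The quadratic term adds strong convexity: comparing the minimizer [p] with points of the segment
    towards [u] gains the term in [(u - p) ^+ 2]. *)
Lemma prox_three_point (R : realType) (D : R -> Prop) (r : R -> R)
    (a c y z p u : R) (g := fun t => a * (t - y) + c * `|t - z| ^+ 2 + r t) :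
  0 <= c -> convex_on (V := R^o) D r -> D p -> D u ->
  (forall t, D t -> g p <= g t) ->
  g p + c * (u - p) ^+ 2 <= g u.
Proof.
move=> c0 cr Dp Du pmin.
(* Minimality of [p] against [l u + (1 - l) p]. Dividing by [l] and letting [l] tend to 0 would give
   the claim; an explicit [l] is used instead. *)
have step l : 0 <= l <= 1 -> l * (g p + c * (1 - l) * (u - p) ^+ 2 - g u) <= 0.
  move=> l01; have [Dq rq] := cr l u p l01 Du Dp.
  have := pmin _ Dq; rewrite /g !real_normK ?num_real//.
  rewrite -[l *: u]/(l * u) -[_ *: p]/(_ * p) in rq *.
  by nra.
set A := g p - g u; set B := c * (u - p) ^+ 2.
have B0 : 0 <= B by rewrite mulr_ge0// sqr_ge0.
have A0 : A <= 0.
  by have := step 1; rewrite lexx ler01 subrr mulr0 mul0r addr0 mul1r; apply.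
suff : A + B <= 0 by rewrite /A /B; lra.
rewrite leNgt; apply/negP => AB.
have Bgt0 : 0 < B by lra.
(* With this [l] the bracket of [step] equals [(A + B) / 2 > 0], a contradiction; [A <= 0] ensures
   [l <= 1]. *)
pose l := (A + B) / (2 * B).
have l0 : 0 < l by rewrite divr_gt0// mulr_gt0.
have lB : l * B = (A + B) / 2 by rewrite /l; field; rewrite gt_eqF.
have l1 : l <= 1 by rewrite -(@ler_pM2r _ B)// lB mul1r; lra.
have := step l; rewrite ltW//= => /(_ l1).
rewrite pmulr_rle0//.
have -> : g p + c * (1 - l) * (u - p) ^+ 2 - g u = A + B - l * B.
  by rewrite /A /B; ring.
by rewrite lB; lra.
Qed.

(** The three-point inequality between two minimizers leaves [c * (q - p) ^+ 2 <= 0]. Uniqueness is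
    what makes the iterates functions of the sampled sets. *)
Lemma argmin_unique (R : realType) (D : R -> Prop) (r : R -> R)
    (a c y z p q : R) (g := fun t => a * (t - y) + c * `|t - z| ^+ 2 + r t) :
  0 < c -> convex_on (V := R^o) D r -> D p -> D q ->
  (forall t, D t -> g p <= g t) -> (forall t, D t -> g q <= g t) -> p = q.
Proof.
move=> c0 cr Dp Dq pmin qmin.
have h := prox_three_point (ltW c0) cr Dp Dq pmin.
have : c * (q - p) ^+ 2 <= 0 by have := qmin p Dp; rewrite /g in h *; lra.
rewrite pmulr_rle0// => h2; apply/eqP; rewrite eq_sym -subr_eq0 -sqrf_eq0.
by rewrite eq_le h2 sqr_ge0.
Qed.

(** * Real-valued versions of psi and F on their domain *)

Section real_part.
Variables (R : realType) (n : nat) (f : 'rV[R]_n -> R) (psi : 'I_n -> R -> \bar R).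
Hypothesis f_convex : convex_on (fun=> True) f.
Hypothesis psi_gtNy : forall i t, (-oo < psi i t)%E.
Hypothesis psi_convex : forall i, extended_convex (psi i).

Definition coord_dom i (t : R) : Prop := (psi i t < +oo)%E.

Definition dom (x : 'rV[R]_n) : Prop := forall i, coord_dom i (x ord0 i).

(** [fine] sends infinite values to 0, so this represents [separable] only on [dom]. *)
Definition separable_fine (x : 'rV[R]_n) : R := \sum_i fine (psi i (x ord0 i)).

Definition composite_fine (x : 'rV[R]_n) : R := f x + separable_fine x.

Lemma coord_domE i t : coord_dom i t -> psi i t = (fine (psi i t))%:E.
Proof. by move=> h; rewrite fineK// fin_numElt psi_gtNy. Qed.

(** At two points of the domain the right-hand side of the extended inequality is finite, hence so
    is the value between them. *)
Lemma coord_convex i : convex_on (V := R^o) (coord_dom i) (fine \o psi i).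
Proof.
move=> a s t a01 Ds Dt /=; have := psi_convex i s t a01.
rewrite -[a *: s]/(a * s) -[_ *: t]/(_ * t) (coord_domE Ds) (coord_domE Dt).
rewrite -!EFinM -EFinD => h.
have Dst : coord_dom i (a * s + (1 - a) * t) by exact: le_lt_trans h (ltry _).
by split=> //; rewrite -lee_fin /= -(coord_domE Dst).
Qed.

Lemma separable_dom x : (separable psi x < +oo)%E -> dom x.
Proof.
move=> sx i; rewrite /coord_dom ltNge leye_eq; apply/negP => /eqP h.
move: sx; rewrite /separable ltNge leye_eq => /negP; apply.
by rewrite esum_eqy ?(introT existsP) //; [exists i; rewrite h eqxx | move=> j _; rewrite gt_eqF].
Qed.

Lemma separableE x : dom x -> separable psi x = (separable_fine x)%:E.
Proof.
by move=> dx; rewrite -sumEFin; apply: eq_bigr => i _; exact: coord_domE.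
Qed.

Lemma compositeE x : dom x -> composite f psi x = (composite_fine x)%:E.
Proof. by move=> dx; rewrite /composite separableE. Qed.

Lemma composite_dom x : (composite f psi x < +oo)%E -> dom x.
Proof.
move=> h; apply: separable_dom; move: h; rewrite /composite.
by case: separable => [r _||] //=; rewrite ltry.
Qed.

Lemma separable_convex : convex_on dom separable_fine.
Proof.
move=> a x y a01 Dx Dy; split.
  move=> i; rewrite !mxE.
  by have [] := coord_convex a01 (Dx i) (Dy i).
rewrite !mulr_sumr -big_split /=; apply: ler_sum => i _; rewrite !mxE.
by have [] := coord_convex a01 (Dx i) (Dy i).
Qed.

Lemma composite_convex : convex_on dom composite_fine.
Proof.
move=> a x y a01 Dx Dy; have [Dxy sxy] := separable_convex a01 Dx Dy.
split=> //; rewrite /composite_fine !mulrDr addrACA lerD//.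
by have [] := f_convex a01 (x := x) (y := y).
Qed.

End real_part.

(** * The weighted squared norm *)

Lemma wnormsq_ge0 (R : realType) (n : nat) (v : 'I_n -> R) (x : 'rV[R]_n) :
  (forall i, 0 < v i) -> 0 <= wnormsq v x.
Proof. by move=> v0; rewrite sumr_ge0// => i _; rewrite mulr_ge0 ?sqr_ge0// ltW. Qed.

(** In each coordinate the convexity defect is exactly [a * (1 - a) * w * (X - Y) ^+ 2]. *)
Lemma wnormsq_convex (R : realType) (n : nat) (v : 'I_n -> R) (u : 'rV[R]_n) :
  (forall i, 0 < v i) -> convex_on (fun=> True) (fun x => wnormsq v (x - u)).
Proof.
move=> v0 a x y a01 _ _; split=> //; rewrite !mulr_sumr -big_split /=.
apply: ler_sum => i _; rewrite !mxE.
have := v0 i; set X := x _ _; set Y := y _ _; set U := u _ _; set w := v i => w0.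
have -> : a * X + (1 - a) * Y - U = a * (X - U) + (1 - a) * (Y - U) by ring.
rewrite -subr_ge0.
have -> : a * (w * (X - U) ^+ 2) + (1 - a) * (w * (Y - U) ^+ 2) -
  w * (a * (X - U) + (1 - a) * (Y - U)) ^+ 2 = a * (1 - a) * w * (X - Y) ^+ 2 by ring.
case/andP: a01 => a0 a1; apply: mulr_ge0; last exact: sqr_ge0.
by apply: mulr_ge0; [rewrite mulr_ge0 ?subr_ge0 | exact: ltW].
Qed.

(** * Expectations over sampling histories *)

(** [G (X w)] is a finite combination of indicators of the fibres of [X], so measurability of these
    fibres suffices. *)
Lemma integral_finite_range (R : realType) (d : measure_display)
    (T : measurableType d) (P : probability T R) (I : finType) (X : T -> I)
    (G : I -> R) :
  (forall i, measurable (X @^-1` [set i])) ->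
  (\int[P]_w (G (X w))%:E = \sum_i (G i)%:E * P (X @^-1` [set i]))%E.
Proof.
move=> mX.
transitivity (\int[P]_w \sum_(i <- index_enum I)
    ((G i)%:E * (\1_(X @^-1` [set i]) w)%:E))%E.
  apply: eq_integral => w _; rewrite (bigD1 (X w)) //= big1 ?adde0.
    by rewrite indicE mem_set// mule1.
  move=> i iX; rewrite indicE memNset ?mule0//= => XwE.
  by rewrite XwE eqxx in iX.
have int i : P.-integrable setT (EFin \o \1_(X @^-1` [set i])).
  exact: integrable_indic.
rewrite integral_sum//; last by move=> i; exact: (integrableZl measurableT _ (int i)).
apply: eq_bigr => i _.
by rewrite (integralZl measurableT (int i)) integral_indic// setIT.
Qed.

(** * Product weights and resampling of one coordinate *)

Section resampling.
Variables (R : realType) (I : finType) (q : I -> R) (k : nat).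
Hypothesis q1 : \sum_A q A = 1.

Definition prod_weight (h : {ffun 'I_k -> I}) : R := \prod_j q (h j).

Definition expect (g : {ffun 'I_k -> I} -> R) : R := \sum_h prod_weight h * g h.

Definition resample (h : {ffun 'I_k -> I}) (j : 'I_k) (A : I) :=
  [ffun i => if i == j then A else h i].

(** Written without division, so that it also holds when [q (h j)] is zero. *)
Lemma prod_weight_resample h j A :
  prod_weight (resample h j A) * q (h j) = prod_weight h * q A.
Proof.
rewrite /prod_weight (bigD1 j) //= [in RHS](bigD1 j) //= ffunE eqxx.
rewrite (eq_bigr (q \o h)); last by move=> i /negbTE ij; rewrite ffunE ij.
by rewrite /=; ring.
Qed.

(** A finite tower property. Exchanging the entry [h j] with an independent draw [A] is an
    involution on pairs [(h, A)] that preserves their joint weight. *)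
Lemma expect_resample (j : 'I_k) g :
  expect g = expect (fun h => \sum_A q A * g (resample h j A)).
Proof.
pose s (p : {ffun 'I_k -> I} * I) := (resample p.1 j p.2, p.1 j).
have sK : involutive s.
  move=> [h A]; rewrite /s /= ffunE eqxx; congr pair.
  by apply/ffunP => i; rewrite !ffunE; case: eqP => [->|].
pose W (p : {ffun 'I_k -> I} * I) := prod_weight p.1 * q p.2 * g p.1.
transitivity (\sum_p W p).
  rewrite -(pair_bigA _ (fun h A => W (h, A))) /=; apply: eq_bigr => h _.
  by rewrite /W /= -mulr_suml -mulr_sumr q1 mulr1.
rewrite (reindex_inj (inv_inj sK)) /=.
rewrite -(pair_bigA _ (fun h A => W (s (h, A)))) /=; apply: eq_bigr => h _.
rewrite mulr_sumr; apply: eq_bigr => A _.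
by rewrite /W /= prod_weight_resample mulrA.
Qed.

Lemma prod_weight_sum1 : \sum_h prod_weight h = 1.
Proof.
by rewrite /prod_weight -(bigA_distr_bigA (fun _ => q)) big1.
Qed.

Hypothesis q0 : forall A, 0 <= q A.

Lemma prod_weight_ge0 h : 0 <= prod_weight h.
Proof. by apply: prodr_ge0. Qed.

Lemma expect_cst c : expect (fun=> c) = c.
Proof. by rewrite /expect -mulr_suml prod_weight_sum1 mul1r. Qed.

(** The comparison is restricted to histories of positive weight because only those are known to
    come from an outcome. *)
Lemma le_expect g1 g2 : (forall h, 0 < prod_weight h -> g1 h <= g2 h) ->
  expect g1 <= expect g2.
Proof.
move=> g12; apply: ler_sum => h _.
have := prod_weight_ge0 h; rewrite le_eqVlt => /predU1P[<-|h0].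
  by rewrite !mul0r.
by rewrite ler_pM2l// g12.
Qed.

Lemma expectD g1 g2 : expect (fun h => g1 h + g2 h) = expect g1 + expect g2.
Proof. by rewrite -big_split; apply: eq_bigr => h _; rewrite mulrDr. Qed.

Lemma expectZ c g : expect (fun h => c * g h) = c * expect g.
Proof. by rewrite mulr_sumr; apply: eq_bigr => h _; rewrite mulrCA. Qed.

Lemma expect_sum m (g : 'I_m -> _) :
  expect (fun h => \sum_i g i h) = \sum_i expect (g i).
Proof.
rewrite exchange_big /=; apply: eq_bigr => h _; rewrite mulr_sumr //.
Qed.

Lemma prod_weight_gt0 h j : 0 < prod_weight h -> 0 < q (h j).
Proof.
rewrite /prod_weight lt_neqAle eq_sym => /andP[/prodf_neq0 h0 _].
by rewrite lt_neqAle q0 eq_sym h0.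
Qed.

Lemma prod_weight_resample_gt0 h j A :
  0 < prod_weight h -> 0 < q A -> 0 < prod_weight (resample h j A).
Proof.
move=> h0 A0; have h1 := prod_weight_gt0 j h0.
by rewrite -(pmulr_lgt0 _ h1) prod_weight_resample mulr_gt0.
Qed.

End resampling.

(** * The law of the sampling and of the history *)

Section sampling.
Variables (R : realType) (d : measure_display) (T : measurableType d).
Variables (P : probability T R) (n : nat) (tau : R).
Variables (Shat : {RV P >-> {set 'I_n}}) (S : nat -> {RV P >-> {set 'I_n}}).
Hypothesis Shat_uniform : forall i j : 'I_n,
      P [set w | i \in Shat w] = P [set w | j \in Shat w].
Hypothesis tauE : ('E_P[fun w => (#|Shat w|%:R)%R] = tau%:E)%E.
Hypothesis S_indep : mutually_independent S.
Hypothesis S_distr : forall j, same_distribution (S j) Shat.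

Definition sampling_prob (A : {set 'I_n}) : R := fine (P (Shat @^-1` [set A])).

Definition history k (w : T) : {ffun 'I_k -> {set 'I_n}} := [ffun j => S (nat_of_ord j) w].

Lemma measurable_sampling (X : {RV P >-> {set 'I_n}}) (B : set {set 'I_n}) :
  measurable (X @^-1` B).
Proof. by rewrite -[_ @^-1` _]setTI; apply: measurable_funPT. Qed.

Lemma sampling_probE A : P (Shat @^-1` [set A]) = (sampling_prob A)%:E.
Proof.
by rewrite /sampling_prob fineK// fin_num_measure//; exact: measurable_sampling.
Qed.

Lemma sampling_prob_ge0 A : 0 <= sampling_prob A.
Proof. by rewrite fine_ge0. Qed.

Lemma sampling_integral (G : {set 'I_n} -> R) :
  (\int[P]_w (G (Shat w))%:E)%E = (\sum_A sampling_prob A * G A)%:E.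
Proof.
rewrite integral_finite_range; last by move=> i; exact: measurable_sampling.
by rewrite -sumEFin; apply: eq_bigr => A _; rewrite sampling_probE muleC.
Qed.

Lemma sampling_prob_sum1 : \sum_A sampling_prob A = 1.
Proof.
have := sampling_integral (fun=> 1).
rewrite integral_cst// [X in (1 * X)%E](probability_setT P) mule1 => -[->].
by apply: eq_bigr => A _; rewrite mulr1.
Qed.

Lemma sampling_card : \sum_A sampling_prob A * #|A|%:R = tau.
Proof.
apply: EFin_inj; rewrite -tauE expectation.unlock.
exact/esym/(sampling_integral (fun A => #|A|%:R)).
Qed.

(** Double counting: the [n] inclusion probabilities are equal, and they sum to the mean cardinality
    [tau]. *)
Lemma sampling_mem (i : 'I_n) :
  \sum_A sampling_prob A * (i \in A)%:R = tau / n%:R.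
Proof.
pose p i := \sum_A sampling_prob A * (i \in A)%:R.
have pE j : (p j)%:E = P [set w | j \in Shat w].
  have mj : measurable [set w | j \in Shat w].
    exact: (measurable_sampling Shat (fun A : {set _} => j \in A)).
  rewrite /p -(sampling_integral (fun A => (j \in A)%:R)) -[X in P X]setIT -integral_indic//.
  apply: eq_integral => w _; rewrite indicE; congr (_%:R%:E).
  by case: (boolP (j \in Shat w)) => jS; [rewrite mem_set | rewrite memNset//=; exact/negP].
have pc j : p j = p i by apply: EFin_inj; rewrite !pE.
have n0 : n%:R != 0 :> R by rewrite pnatr_eq0 -lt0n (leq_trans _ (ltn_ord i)).
apply: (mulIf n0); rewrite divfK// -sampling_card.
transitivity (\sum_(j < n) p j).
  rewrite [RHS](eq_bigr (fun=> p i)); last by move=> j _; exact: pc.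
  by rewrite sumr_const card_ord mulr_natr.
rewrite exchange_big /=; apply: eq_bigr => A _; rewrite -mulr_sumr; congr (_ * _).
rewrite -natr_sum -sum1_card [in RHS]big_mkcond /=; congr (_%:R).
Qed.

Lemma history_prob k h :
  P (history k @^-1` [set h]) = (prod_weight sampling_prob h)%:E.
Proof.
(* Independence asks for an event at every natural index; indices from [k] on receive the full
   set. *)
pose B j := if insub j is Some i then [set h i] else setT : set {set 'I_n}.
have := S_indep (iota_uniq 0 k) (B := B) (fun j => I).
rewrite -[in X in _ = X -> _](subn0 k) -/(index_iota 0 k) big_mkord.
have -> : \bigcap_(j in [set` iota 0 k]) (S j @^-1` B j) = history k @^-1` [set h].
  apply/seteqP; split => w /=.
    move=> H; apply/ffunP => j; rewrite ffunE.
    have := H (nat_of_ord j); rewrite /= mem_iota add0n ltn_ord /B valK /=.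
    exact.
  move=> hE j /=; rewrite mem_iota add0n /B => /andP[_ jk].
  by rewrite insubT /= -hE ffunE.
move=> ->; rewrite /prod_weight -prodEFin; apply: eq_bigr => j _.
rewrite /B valK -sampling_probE.
exact: (S_distr (nat_of_ord j) (B := [set h j])).
Qed.

Lemma history_integral k (G : {ffun 'I_k -> {set 'I_n}} -> R) :
  (\int[P]_w (G (history k w))%:E)%E = (expect sampling_prob G)%:E.
Proof.
rewrite integral_finite_range; last first.
  move=> h.
  rewrite (_ : _ @^-1` _ = \bigcap_(j in [set: 'I_k]) (S (nat_of_ord j) @^-1` [set h j])).
    by apply: fin_bigcap_measurable => // j _; exact: measurable_sampling.
  apply/seteqP; split => w /=.
    by move=> <- j _ /=; rewrite ffunE.
  by move=> H; apply/ffunP => j; rewrite ffunE; exact: (H j).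
rewrite -sumEFin; apply: eq_bigr => h _; by rewrite history_prob muleC.
Qed.

(** An event of positive probability is nonempty. This supplies an outcome at which the hypothesis
    on runs can be used. *)
Lemma history_surj k h : 0 < prod_weight sampling_prob h ->
  exists w, history k w = h.
Proof.
move=> h0; apply: contrapT => nw.
have : P (history k @^-1` [set h]) = 0%E.
  rewrite (_ : _ @^-1` _ = set0) ?measure0//.
  by apply/seteqP; split => w //= hw; apply: nw; exists w.
by rewrite history_prob => -[] h1; rewrite h1 ltxx in h0.
Qed.

End sampling.

(** * Runs of APPROX *)

Lemma restrict_vecE (R : realType) (n : nat) (h : 'rV[R]_n) (A : {set 'I_n}) i :
  restrict_vec h A ord0 i = h ord0 i * (i \in A)%:R.
Proof.
rewrite /restrict_vec summxE; case: (boolP (i \in A)) => iA.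
  rewrite (bigD1 i) //= !mxE !eqxx big1 ?addr0// => j /andP[_ ji].
  by rewrite !mxE eq_sym (negbTE ji) andbF mulr0.
rewrite mulr0 big1// => j jA; rewrite !mxE.
case: (i =P j) => [ij|_]; last by rewrite andbF mulr0.
by rewrite ij jA in iA.
Qed.

Section run.
Variables (R : realType) (n : nat) (f : 'rV[R]_n -> R) (psi : 'I_n -> R -> \bar R).
Variables (tau : R) (v : 'I_n -> R) (x0 : 'rV[R]_n).
Hypothesis th0 : 0 < tau / n%:R <= 1.
Hypothesis v_gt0 : forall i, 0 < v i.
Hypothesis psi_gtNy : forall i t, (-oo < psi i t)%E.
Hypothesis psi_convex : forall i, extended_convex (psi i).
Hypothesis x0_dom : dom psi x0.
Let t0 := tau / n%:R.
Let t00 : 0 < t0. Proof. by case/andP: th0. Qed.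

Definition coord_objective_fine (th : R) (y z : 'rV[R]_n) i (t : R) : R :=
  partial f i y * (t - y ord0 i)
  + th * n%:R * v i / (2 * tau) * `|t - z ord0 i| ^+ 2 + fine (psi i t).

(** Comparison with the coordinate of [x0], where the objective is finite, puts the minimizer in the
    domain; minimality then becomes an inequality between reals. *)
Lemma coord_argmin th y z i p :
  is_argmin (coord_objective f psi tau v th y z i) p ->
  coord_dom psi i p /\ forall t, coord_dom psi i t ->
    coord_objective_fine th y z i p <= coord_objective_fine th y z i t.
Proof.
move=> pmin.
have Dp : coord_dom psi i p.
  have := pmin (x0 ord0 i); rewrite /coord_objective.
  rewrite (coord_domE psi_gtNy (x0_dom i)) -EFinD => /le_lt_trans.
  move=> /(_ +oo%E (ltry _)); rewrite /coord_dom.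
  by case: (psi i p) => [r _||] //; rewrite ltry.
split=> // t Dt; have := pmin t; rewrite /coord_objective.
by rewrite (coord_domE psi_gtNy Dt) (coord_domE psi_gtNy Dp) -!EFinD lee_fin.
Qed.

Lemma coord_coef_gt0 k i : 0 < theta t0 k * n%:R * v i / (2 * tau).
Proof.
have -> : theta t0 k * n%:R * v i / (2 * tau) = theta t0 k * v i / 2 * t0^-1.
  by rewrite /t0 !invfM invrK; ring.
by rewrite !mulr_gt0 ?invr_gt0// theta_gt0.
Qed.

Lemma coord_argmin_unique k y z i p q :
  is_argmin (coord_objective f psi tau v (theta t0 k) y z i) p ->
  is_argmin (coord_objective f psi tau v (theta t0 k) y z i) q -> p = q.
Proof.
move=> /coord_argmin[Dp pmin] /coord_argmin[Dq qmin].
exact: (argmin_unique (coord_coef_gt0 k i)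
  (coord_convex psi_gtNy psi_convex (i := i)) Dp Dq pmin qmin).
Qed.

Section one_run.
Variables (s : nat -> {set 'I_n}) (x y z : nat -> 'rV[R]_n).
Hypothesis run : approx_run f psi tau v x0 s x y z.

Lemma run_z_dom k : dom psi (z k).
Proof.
elim: k => [|k IHk]; first by rewrite (approx_z0 run).
move=> i; case: (boolP (i \in s k)) => iS.
  by have [] := coord_argmin (approx_z_in run iS).
by rewrite (approx_z_notin run iS).
Qed.

(** Both sides obey the recursion of [gamma_sumS]. *)
Lemma run_x_comb k : x k = \sum_(i < k.+1) gamma n tau k i *: z i.
Proof.
elim: k => [|k IHk].
  by rewrite big_ord_recr big_ord0 /= add0r scale1r (approx_x0 run) (approx_z0 run).
by rewrite (gamma_sumS th0) -IHk (approx_x run) (approx_y run).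
Qed.

Lemma run_x_dom k : dom psi (x k).
Proof.
rewrite run_x_comb.
by have [] := jensen (c := fun i : 'I_k.+1 => gamma n tau k i)
  (p := fun i : 'I_k.+1 => z i) (separable_convex psi_gtNy psi_convex)
  (fun i => gamma_ge0 th0 k i) (gamma_sum1 th0 k) (fun i => run_z_dom i).
Qed.

(** The psi part of [Fhat_k]. Unlike psi at [x k], it satisfies an exact affine recursion, given by
    [gamma_sumSr]. *)
Definition psi_hat (z' : nat -> 'rV[R]_n) k : R :=
  \sum_(i < k.+1) gamma n tau k i * separable_fine psi (z' i).

Lemma run_psi_hat k : separable_fine psi (x k) <= psi_hat z k.
Proof.
rewrite run_x_comb.
by have [] := jensen (c := fun i : 'I_k.+1 => gamma n tau k i)
  (p := fun i : 'I_k.+1 => z i) (separable_convex psi_gtNy psi_convex)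
  (fun i => gamma_ge0 th0 k i) (gamma_sum1 th0 k) (fun i => run_z_dom i).
Qed.

Lemma run_wnormsq k u : wnormsq v (x k - u) <=
  \sum_(i < k.+1) gamma n tau k i * wnormsq v (z i - u).
Proof.
rewrite run_x_comb.
by have [] := jensen (c := fun i : 'I_k.+1 => gamma n tau k i)
  (p := fun i : 'I_k.+1 => z i) (wnormsq_convex u v_gt0)
  (fun i => gamma_ge0 th0 k i) (gamma_sum1 th0 k) (fun i => I).
Qed.

End one_run.

(** Sampled coordinates agree because argmins are unique, the others because they are copied. The
    samples before index [k] fix the iterates up to and including index [k]. *)
Lemma run_determined s s' x x' y y' z z' k :
  approx_run f psi tau v x0 s x y z -> approx_run f psi tau v x0 s' x' y' z' ->
  (forall j, (j < k)%N -> s j = s' j) ->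
  forall j, (j <= k)%N -> [/\ x j = x' j, y j = y' j & z j = z' j].
Proof.
move=> r r' ss'; elim=> [|j IHj] jk.
  rewrite (approx_y r) (approx_y r') (approx_z0 r) (approx_z0 r').
  by rewrite (approx_x0 r) (approx_x0 r').
have [xj yj zj] := IHj (ltnW jk).
have zS : z j.+1 = z' j.+1.
  apply/rowP => i; case: (boolP (i \in s j)) => iS.
    have iS' := iS; rewrite ss'// in iS'.
    apply: (@coord_argmin_unique j (y j) (z j) i).
      exact: (approx_z_in r iS).
    by rewrite yj zj; exact: (approx_z_in r' iS').
  have iS' := iS; rewrite ss'// in iS'.
  by rewrite (approx_z_notin r iS) (approx_z_notin r' iS') zj.
have xS : x j.+1 = x' j.+1.
  by rewrite (approx_x r) (approx_x r') zS zj yj.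
by split=> //; rewrite (approx_y r) (approx_y r') xS zS.
Qed.

End run.

(** * Expected progress of a single step *)

Section one_step.
Variables (R : realType) (n : nat) (f : 'rV[R]_n -> R) (psi : 'I_n -> R -> \bar R).
Variables (tau : R) (v : 'I_n -> R) (q : {set 'I_n} -> R).
Hypothesis th0 : 0 < tau / n%:R <= 1.
Let t0 := tau / n%:R.
Hypothesis f_convex : convex_on (fun=> True) f.
Hypothesis f_diff : forall u : 'rV[R]_n, differentiable f u.
Hypothesis q1 : \sum_A q A = 1.
Hypothesis q_mem : forall i, \sum_A q A * (i \in A)%:R = t0.
Hypothesis q_eso : forall x h : 'rV[R]_n,
  \sum_A q A * f (x + restrict_vec h A) <=
  f x + t0 * (\sum_i partial f i x * h ord0 i + 2^-1 * wnormsq v h).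
Let t00 : 0 < t0. Proof. by case/andP: th0. Qed.

(* Coordinate [i] of [z + restrict_vec (zt - z) A] is [zt i] with probability
   [t0] and [z i] otherwise. *)
Lemma mean_restrict (g : 'I_n -> R -> R) (z zt : 'rV[R]_n) :
  \sum_A q A * (\sum_i g i ((z + restrict_vec (zt - z) A) ord0 i)) =
  (1 - t0) * \sum_i g i (z ord0 i) + t0 * \sum_i g i (zt ord0 i).
Proof.
under eq_bigr do rewrite mulr_sumr.
rewrite exchange_big /= !mulr_sumr -big_split /=; apply: eq_bigr => i _.
have -> : (1 - t0) * g i (z ord0 i) + t0 * g i (zt ord0 i) =
   1 * g i (z ord0 i) + t0 * (g i (zt ord0 i) - g i (z ord0 i)) by ring.
rewrite -[X in X * _ + _]q1 -(q_mem i) !mulr_suml -big_split /=.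
apply: eq_bigr => A _; rewrite mxE restrict_vecE !mxE; case: (i \in A).
  by rewrite !mulr1 [_ + (_ - _)]addrC subrK; ring.
by rewrite !mulr0 addr0; ring.
Qed.

Lemma mean_affine (F1 F2 F3 : {set 'I_n} -> R) a b c e :
  \sum_A q A * (a * F1 A + b * F2 A + c * F3 A + e) =
  a * (\sum_A q A * F1 A) + b * (\sum_A q A * F2 A)
  + c * (\sum_A q A * F3 A) + e.
Proof.
rewrite -[in RHS](mulr1 e) -q1 !mulr_sumr -!big_split /=.
by apply: eq_bigr => A _; ring.
Qed.

(** Here [zt] is the virtual update of all coordinates, of which a draw [A] reveals those in [A].
    The ESO bound, the summed three-point inequality at [u], and tangent bounds at [x] and [u] with
    weights [1 - th] and [th] combine linearly. *)
Lemma one_step (th Psi : R) (x z zt u : 'rV[R]_n)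
    (y := (1 - th) *: x + th *: z)
    (zA := fun A => z + restrict_vec (zt - z) A)
    (r := separable_fine psi) (Fu := f u + r u) :
  0 < th <= 1 ->
  (forall i, coord_objective_fine f psi tau v th y z i (zt ord0 i)
     + th * n%:R * v i / (2 * tau) * (u ord0 i - zt ord0 i) ^+ 2
     <= coord_objective_fine f psi tau v th y z i (u ord0 i)) ->
  \sum_A q A *
    ((th ^+ 2)^-1 * (f (y + (n%:R / tau * th) *: (zA A - z))
       + ((1 - th) * Psi + th * r z + (n%:R / tau * th) * (r (zA A) - r z)) - Fu)
     + (2 * t0 ^+ 2)^-1 * wnormsq v (zA A - u)) <=
  (1 - th) / th ^+ 2 * (f x + Psi - Fu) + (2 * t0 ^+ 2)^-1 * wnormsq v (z - u).
Proof.
move=> /andP[thgt0 th1] prox.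
have nt : n%:R / tau = t0^-1 by rewrite /t0 invfM invrK mulrC.
rewrite nt.
have eqle (a b : R) : a = b -> a <= b by move=> ->.
pose c := t0^-1 * th.
pose g i := partial f i y.
pose lin (w : 'rV[R]_n) := \sum_i g i * w ord0 i.
(* ESO for the displacement [c *: (zt - z)]: restriction commutes with scaling, [t0 * c = th] and
   [t0 * c ^+ 2 = th ^+ 2 / t0]. *)
have E1 : \sum_A q A * f (y + c *: (zA A - z)) <=
    f y + th * lin (zt - z) + th ^+ 2 / (2 * t0) * wnormsq v (zt - z).
  have := q_eso y (c *: (zt - z)).
  rewrite (eq_bigr (fun A => q A * f (y + c *: (zA A - z)))); last first.
    move=> A _; congr (_ * f (_ + _)); apply/rowP => i.
    by rewrite restrict_vecE /zA !mxE restrict_vecE !mxE; ring.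
  move=> /le_trans; apply; apply: eqle.
  have -> : \sum_i partial f i y * (c *: (zt - z)) ord0 i = c * lin (zt - z).
    by rewrite /lin mulr_sumr; apply: eq_bigr => i _; rewrite [in LHS]mxE /g; ring.
  have -> : wnormsq v (c *: (zt - z)) = c ^+ 2 * wnormsq v (zt - z).
    by rewrite /wnormsq mulr_sumr; apply: eq_bigr => i _; rewrite [in LHS]mxE; ring.
  by rewrite /c; field; rewrite gt_eqF.
have E2 : \sum_A q A * r (zA A) = (1 - t0) * r z + t0 * r zt.
  exact: (mean_restrict (fun i => fine \o psi i)).
have E3 : \sum_A q A * wnormsq v (zA A - u) =
    (1 - t0) * wnormsq v (z - u) + t0 * wnormsq v (zt - u).
  have := mean_restrict (fun i t => v i * (t - u ord0 i) ^+ 2) z zt.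
  rewrite /wnormsq => e.
  have mE (a : 'rV[R]_n) : \sum_i v i * (a - u) ord0 i ^+ 2 =
    \sum_i v i * (a ord0 i - u ord0 i) ^+ 2.
    by apply: eq_bigr => i _; rewrite !mxE.
  rewrite !mE -e; apply: eq_bigr => A _; by rewrite mE.
have P : lin (zt - y) + th / (2 * t0) * wnormsq v (zt - z) + r zt
    + th / (2 * t0) * wnormsq v (zt - u)
    <= lin (u - y) + th / (2 * t0) * wnormsq v (z - u) + r u.
  rewrite /lin /wnormsq /r /separable_fine !mulr_sumr -!big_split /=.
  apply: ler_sum => i _; have := prox i; rewrite /coord_objective_fine.
  rewrite !real_normK ?num_real// -/(g i) !mxE.
  have -> : th * n%:R * v i / (2 * tau) = th / (2 * t0) * v i.
    by rewrite /t0 !invfM invrK; ring.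
  by move: (psi i _) (psi i _) => ? ?; lra.
have T1 := convex_ge_tangent x f_convex (f_diff y).
have T2 := convex_ge_tangent u f_convex (f_diff y).
rewrite -/(lin (x - y)) in T1; rewrite -/(lin (u - y)) in T2.
(* This holds because [th *: z = y - (1 - th) *: x]. *)
have L : th * lin (zt - z) = th * lin (zt - y) + (1 - th) * lin (x - y).
  rewrite /lin !mulr_sumr -big_split /=; apply: eq_bigr => i _.
  by rewrite /y !mxE; ring.
set Nz := wnormsq v (z - u) in P E3 *.
set Nt := wnormsq v (zt - u) in P E3 *.
set QF := \sum_A _ in E1.
set K := th / (2 * t0) in P.
(* In the mean the factor [c * t0 = th] replaces [th * r z] by [th * r zt]. *)
pose B := (1 - th) * Psi + th * r zt - Fu.
rewrite [leLHS](_ : _ = (th ^+ 2)^-1 * (QF + B)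
    + (2 * t0 ^+ 2)^-1 * ((1 - t0) * Nz + t0 * Nt)); last first.
  transitivity (\sum_A q A * ((th ^+ 2)^-1 * f (y + c *: (zA A - z))
      + (th ^+ 2)^-1 * c * r (zA A) + (2 * t0 ^+ 2)^-1 * wnormsq v (zA A - u)
      + (th ^+ 2)^-1 * ((1 - th) * Psi + th * r z - c * r z - Fu))).
    by apply: eq_bigr => A _; rewrite -/c; ring.
  rewrite mean_affine E2 E3 -/QF /B /c.
  by field; rewrite !gt_eqF.
have E4 : QF + B <= (1 - th) * (f x + Psi - Fu) + th * K * (Nz - Nt).
  have P' := ler_wpM2l (ltW thgt0) P.
  have T1' : (1 - th) * (f y + lin (x - y)) <= (1 - th) * f x.
    by rewrite ler_wpM2l// subr_ge0.
  have T2' := ler_wpM2l (ltW thgt0) T2.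
  have e : th ^+ 2 / (2 * t0) * wnormsq v (zt - z)
      = th * (K * wnormsq v (zt - z)) by rewrite /K; ring.
  rewrite e L in E1; rewrite /B /Fu.
  by lra.
have th2 : 0 <= (th ^+ 2)^-1 by rewrite invr_ge0 sqr_ge0.
(* After division by [th ^+ 2] the terms in [Nt] cancel and [Nz] keeps the coefficient
   [1 / (2 t0^2)]. *)
have := ler_wpM2l th2 E4; rewrite -(lerD2r ((2 * t0 ^+ 2)^-1 * ((1 - t0) * Nz + t0 * Nt))).
move=> /le_trans; apply; apply: eqle; rewrite /K; field.
by rewrite !gt_eqF.
Qed.

End one_step.

(** * The descent argument *)

Section descent.
Variables (R : realType) (d : measure_display) (T : measurableType d).
Variables (P : probability T R) (n : nat) (f : 'rV[R]_n -> R).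
Variables (psi : 'I_n -> R -> \bar R) (v : 'I_n -> R) (xstar x0 : 'rV[R]_n).
Variables (tau : R) (Shat : {RV P >-> {set 'I_n}}).
Variables (S : nat -> {RV P >-> {set 'I_n}}) (x y z : nat -> T -> 'rV[R]_n).
Variable k : nat.
Let t0 := tau / n%:R.
Hypothesis th0 : 0 < tau / n%:R <= 1.
Hypothesis f_convex : convex_on (fun=> True) f.
Hypothesis f_diff : forall u : 'rV[R]_n, differentiable f u.
Hypothesis psi_gtNy : forall i t, (-oo < psi i t)%E.
Hypothesis psi_convex : forall i, extended_convex (psi i).
Hypothesis v_gt0 : forall i, 0 < v i.
Hypothesis Shat_mem : forall i, \sum_A sampling_prob Shat A * (i \in A)%:R = t0.
Hypothesis f_eso : eso f Shat tau v.
Hypothesis S_indep : mutually_independent S.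
Hypothesis S_distr : forall j, same_distribution (S j) Shat.
Hypothesis xstar_dom : dom psi xstar.
Hypothesis xstar_min : forall u, dom psi u ->
  composite_fine f psi xstar <= composite_fine f psi u.
Hypothesis x0_dom : dom psi x0.
Hypothesis runs : forall w, approx_run f psi tau v x0
  (fun j => S j w) (fun j => x j w) (fun j => y j w) (fun j => z j w).
(** A choice of one outcome per history, arbitrary when the history never occurs. The expectation
    [E] evaluates iterates at these outcomes. *)
Variable rep : {ffun 'I_k -> {set 'I_n}} -> T.
Hypothesis repP : forall h, (exists w, history S k w = h) ->
  history S k (rep h) = h.

Let q := sampling_prob Shat.
Let t00 : 0 < t0. Proof. by case/andP: th0. Qed.
Let q1 : \sum_A q A = 1. Proof. exact: sampling_prob_sum1. Qed.
Let q0 A : 0 <= q A. Proof. exact: sampling_prob_ge0. Qed.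
Let Fr := composite_fine f psi.
Let gap u := Fr u - Fr xstar.
Let E (g : T -> R) := expect q (fun h => g (rep h)).

Definition lyapunov j w : R :=
  inv_theta_sq t0 j *
    (f (x j w) + psi_hat psi tau (fun i => z i w) j - composite_fine f psi xstar)
  + (2 * t0 ^+ 2)^-1 * wnormsq v (z j w - xstar).

Definition Delta_fine u : R :=
  (1 - t0) / t0 ^+ 2 * (composite_fine f psi u - composite_fine f psi xstar)
  + (2 * t0 ^+ 2)^-1 * wnormsq v (u - xstar).

Lemma history_rep h : 0 < prod_weight q h -> history S k (rep h) = h.
Proof. by move=> h0; apply: repP; exact: (history_surj S_indep S_distr h0). Qed.

Lemma eso_sum (u h : 'rV[R]_n) : \sum_A q A * f (u + restrict_vec h A) <=
  f u + t0 * (\sum_i partial f i u * h ord0 i + 2^-1 * wnormsq v h).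
Proof.
have := f_eso u h; rewrite expectation.unlock.
by rewrite (sampling_integral Shat (fun A => f (u + restrict_vec h A))) lee_fin.
Qed.

Lemma runs_determined j w w' : (forall i, (i < j)%N -> S i w = S i w') ->
  forall i, (i <= j)%N -> [/\ x i w = x i w', y i w = y i w' & z i w = z i w'].
Proof.
exact: (run_determined th0 v_gt0 psi_gtNy psi_convex x0_dom (runs w) (runs w')).
Qed.

(** Resampling coordinate [j] leaves the iterates up to index [j] unchanged, so the inner sum over
    [A] is that of [one_step] with [u = xstar]. *)
Lemma lyapunov_step (j : 'I_k) : E (lyapunov j.+1) <= E (lyapunov j).
Proof.
rewrite /E (expect_resample q1 j) le_expect// => h h0.
set w := rep h; pose wA A := rep (resample h j A).
have hw : history S k w = h by exact: history_rep.
have hA A : 0 < q A -> history S k (wA A) = resample h j A.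
  by move=> qA; apply: history_rep; exact: prod_weight_resample_gt0.
have SE (i : 'I_k) A : 0 < q A -> S i (wA A) = if i == j then A else S i w.
  move=> qA; have := congr1 (fun g : {ffun _} => g i) (hA A qA).
  have := congr1 (fun g : {ffun _} => g i) hw.
  by rewrite !ffunE => ->.
have det A : 0 < q A -> forall i, (i <= j)%N ->
    [/\ x i (wA A) = x i w, y i (wA A) = y i w & z i (wA A) = z i w].
  move=> qA; apply: runs_determined => i ij.
  have ik : (i < k)%N by exact: ltn_trans ij _.
  by have := SE (Ordinal ik) A qA; rewrite -val_eqE /= ltn_eqF.
have SA A : 0 < q A -> S j (wA A) = A by move=> qA; rewrite SE// eqxx.
(* Since [t0 > 0], each coordinate belongs to some set of positive probability and is therefore
   updated in some outcome. *)
have exA i : exists A : {set 'I_n}, 0 < q A /\ i \in A.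
  apply: contrapT => nA.
  have : t0 <= 0; last by rewrite leNgt t00.
  rewrite -(Shat_mem i) big1// => A _; rewrite -/(q A).
  case: (boolP (i \in A)) => iA; last by rewrite mulr0.
  have := q0 A; rewrite le_eqVlt => /predU1P[<-|qA]; first by rewrite mul0r.
  by exfalso; apply: nA; exists A.
have [Ai AiP] := boolp.choice exA.
(* The full update is assembled from different outcomes, one per coordinate; by uniqueness of
   argmins the choice of [Ai] does not matter. *)
pose zt := \row_i z j.+1 (wA (Ai i)) ord0 i.
have yE : y j w = (1 - theta t0 j) *: x j w + theta t0 j *: z j w.
  exact: (approx_y (runs w)).
have amin A i : 0 < q A -> i \in A -> is_argmin
    (coord_objective f psi tau v (theta t0 j) (y j w) (z j w) i)
    (z j.+1 (wA A) ord0 i).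
  move=> qA iA; have [_ <- <-] := det A qA j (leqnn j).
  by apply: (approx_z_in (runs (wA A))); rewrite SA.
have zS A : 0 < q A -> z j.+1 (wA A) = z j w + restrict_vec (zt - z j w) A.
  move=> qA; apply/rowP => i; rewrite mxE restrict_vecE !mxE.
  case: (boolP (i \in A)) => iA.
    rewrite mulr1 addrC subrK; have [qi iAi] := AiP i.
    exact: (coord_argmin_unique th0 v_gt0 psi_gtNy psi_convex x0_dom
      (amin A i qA iA) (amin _ i qi iAi)).
  rewrite mulr0 addr0 (approx_z_notin (runs (wA A))) ?SA//.
  by have [_ _ ->] := det A qA j (leqnn j).
have th01 : 0 < theta t0 j <= 1.
  rewrite theta_gt0//=; apply: le_trans (theta_le0 _ t00) _.
  by case/andP: th0.
have prox i : coord_objective_fine f psi tau v (theta t0 j) (y j w) (z j w) i (zt ord0 i)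
     + theta t0 j * n%:R * v i / (2 * tau) * (xstar ord0 i - zt ord0 i) ^+ 2
     <= coord_objective_fine f psi tau v (theta t0 j) (y j w) (z j w) i (xstar ord0 i).
  have [qi iAi] := AiP i; rewrite mxE.
  have [Dz zmin] := coord_argmin psi_gtNy x0_dom (amin _ i qi iAi).
  exact: (prox_three_point (ltW (coord_coef_gt0 th0 v_gt0 j i))
    (coord_convex psi_gtNy psi_convex (i := i)) Dz (xstar_dom i) zmin).
rewrite yE in prox.
have := one_step th0 f_convex f_diff q1 Shat_mem eso_sum
  (psi_hat psi tau (fun i => z i w) j) (x := x j w) th01 prox.
(* Index [j.+1] unfolds to [1 / theta_j^2], while index [j] becomes [(1 - theta_j) / theta_j^2]: the
   two factors in [one_step]. *)
rewrite /lyapunov (inv_theta_sqE j)//; apply: le_trans.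
rewrite le_eqVlt; apply/orP; left; apply/eqP; apply: eq_bigr => A _.
have := q0 A; rewrite le_eqVlt => /predU1P[<-|qA]; first by rewrite !mul0r.
have [xj yj zj] := det A qA j (leqnn j).
congr (_ * (_ * (_ + _ - _) + _ * wnormsq v (_ - _))).
- by rewrite (approx_x (runs (wA A))) yj zj zS// yE.
- rewrite /psi_hat (gamma_sumSr th0 (fun i => separable_fine psi (z i (wA A)))) zj zS//; congr (_ * _ + _ + _).
  by apply: eq_bigr => i _; have [_ _ ->] := det A qA i (ltn_ord i).
- exact: zS.
Qed.

Lemma lyapunov_le j : (j <= k)%N -> E (lyapunov j) <= Delta_fine x0.
Proof.
elim: j => [|j IHj] jk; last first.
  exact: le_trans (lyapunov_step (Ordinal jk)) (IHj (ltnW jk)).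
rewrite /E -[leRHS](expect_cst k q1) le_expect// => h _.
rewrite /lyapunov /psi_hat big_ord_recr big_ord0 /= add0r mul1r.
by rewrite (approx_x0 (runs _)) (approx_z0 (runs _)).
Qed.

Lemma gap_ge0 u : dom psi u -> 0 <= gap u.
Proof. by move=> Du; rewrite subr_ge0 xstar_min. Qed.

Let dist u := (2 * t0 ^+ 2)^-1 * wnormsq v (u - xstar).

(** [Fhat_j] is lowered to [F(x_j)] by [run_psi_hat], its weight being nonnegative. *)
Lemma iterate_bound j : (j <= k)%N ->
  inv_theta_sq t0 j * E (fun w => gap (x j w)) + E (fun w => dist (z j w))
  <= Delta_fine x0.
Proof.
move=> jk; apply: le_trans (lyapunov_le jk).
rewrite /E -expectZ -expectD le_expect// => h _.
rewrite lerD2r ler_wpM2l ?inv_theta_sq_ge0// lerD2r.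
rewrite /Fr /composite_fine lerD2l.
exact: (run_psi_hat th0 psi_gtNy psi_convex x0_dom (runs (rep h))).
Qed.

(** The distance of [x_j] is bounded by the [gamma] average of those of the [z_i], and each of these
    by [iterate_bound]. At [j = 0] the predecessor in [last_weight] would be truncated, hence
    [0 < j]. *)
Lemma expect_Delta_le j : (j <= k)%N -> (0 < j)%N ->
  E (fun w => Delta_fine (x j w)) <=
  Delta_fine x0 - \sum_(i < j.+1) ring_weight n tau j i * E (fun w => gap (x i w)).
Proof.
move=> jk; case: j jk => // j jk _.
rewrite {1}/E expectD expectZ -/(E (fun w => gap (x j.+1 w))).
have dle : expect q (fun h => dist (x j.+1 (rep h))) <=
    \sum_(i < j.+2) gamma n tau j.+1 i * E (fun w => dist (z i w)).
  rewrite (eq_bigr (fun i : 'I_j.+2 =>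
    expect q (fun h => gamma n tau j.+1 i * dist (z i (rep h))))); last first.
    by move=> i _; rewrite expectZ.
  rewrite -expect_sum le_expect// => h _.
  have H := run_wnormsq th0 v_gt0 (runs (rep h)) j.+1 xstar.
  have c0 : 0 <= (2 * t0 ^+ 2)^-1 by rewrite invr_ge0 mulr_ge0 ?sqr_ge0.
  apply: le_trans (ler_wpM2l c0 H) _; rewrite mulr_sumr.
  by apply: ler_sum => i _; rewrite mulrCA.
have sle : \sum_(i < j.+2) gamma n tau j.+1 i * E (fun w => dist (z i w)) <=
    \sum_(i < j.+2) gamma n tau j.+1 i *
       (Delta_fine x0 - inv_theta_sq t0 i * E (fun w => gap (x i w))).
  apply: ler_sum => i _; rewrite ler_wpM2l ?gamma_ge0// lerBrDl.
  by apply: iterate_bound; apply: leq_trans jk; rewrite -ltnS.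
(* The last gap has weight [gamma_j^j / theta_{j-1}^2 = 1 / (t0 * theta_{j-1})], written here at
   [j.+1]. Removing the share [(1 - t0) / t0^2] that belongs to [Delta] leaves [last_weight]. *)
have e : \sum_(i < j.+2) gamma n tau j.+1 i *
       (Delta_fine x0 - inv_theta_sq t0 i * E (fun w => gap (x i w))) =
    Delta_fine x0 - \sum_(i < j.+2) ring_weight n tau j.+1 i * E (fun w => gap (x i w))
     - (1 - t0) / t0 ^+ 2 * E (fun w => gap (x j.+1 w)).
  under eq_bigr do rewrite mulrBr.
  rewrite sumrB -mulr_suml gamma_sum1// mul1r.
  rewrite -[RHS]addrA -opprD; congr (_ - _).
  rewrite big_ord_recr [in RHS]big_ord_recr -[RHS]addrA; congr (_ + _).
    by apply: eq_bigr => i _; rewrite /ring_weight ifT ?mulrA//; exact: (ltn_ord i).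
  rewrite -mulrDl [LHS]mulrA; congr (_ * _); rewrite [nat_of_ord _]/=.
  rewrite gamma_diag// /ring_weight ltnn /last_weight -/t0 subrK.
  rewrite (_ : n%:R / tau = t0^-1); last by rewrite invfM invrK mulrC.
  have t1 := theta_gt0 j t00.
  by rewrite /=; field; rewrite !gt_eqF.
have := le_trans dle sle; rewrite e => h.
rewrite -/t0; lra.
Qed.

Lemma expect_Delta_le0 j : (j <= k)%N ->
  E (fun w => Delta_fine (x j w)) <= Delta_fine x0.
Proof.
case: j => [|j] jk.
  rewrite /E -[leRHS](expect_cst k q1) le_expect// => h _.
  by rewrite (approx_x0 (runs _)).
apply: le_trans (expect_Delta_le jk _) _ => //.
rewrite gerBl sumr_ge0// => i _; rewrite mulr_ge0 ?ring_weight_ge0//.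
rewrite -[leLHS](expect_cst k q1) le_expect// => h _; apply: gap_ge0.
exact: run_x_dom (runs _) _.
Qed.

Lemma Delta_fine_convex : convex_on (dom psi) Delta_fine.
Proof.
move=> a u u' a01 Du Du'.
have [Duu Fuu] := composite_convex f_convex psi_gtNy psi_convex a01 Du Du'.
have [_ wuu] := wnormsq_convex xstar v_gt0 a01 (x := u) (y := u') I I.
split=> //; rewrite /Delta_fine.
have c0 : 0 <= (2 * t0 ^+ 2)^-1 by rewrite invr_ge0 mulr_ge0 ?sqr_ge0.
have c1 : 0 <= (1 - t0) / t0 ^+ 2 by rewrite divr_ge0 ?sqr_ge0// subr_ge0; case/andP: th0.
have H0 := ler_wpM2l c0 wuu; have H1 := ler_wpM2l c1 Fuu.
move: (_ / _) ((_ * _)^-1) H0 H1 => b0 b1 H0 H1; lra.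
Qed.

Lemma ring_weight_sum1 : \sum_(i < k.+1) ring_weight n tau k i / total_weight n tau k = 1.
Proof.
by rewrite -mulr_suml -total_weightE// divff// gt_eqF// total_weight_gt0.
Qed.

Lemma ring_coef_ge0 (i : 'I_k.+1) : 0 <= ring_weight n tau k i / total_weight n tau k.
Proof. by rewrite divr_ge0 ?ring_weight_ge0// ltW// total_weight_gt0. Qed.

Let ring w := ring_point tau k (fun j => x j w).

Lemma ring_point_jensen (g : 'rV[R]_n -> R) w : convex_on (dom psi) g ->
  dom psi (ring w) /\
  g (ring w) <= \sum_(i < k.+1) ring_weight n tau k i / total_weight n tau k * g (x i w).
Proof.
move=> cg; rewrite /ring ring_pointE//.
apply: (jensen (p := fun i : 'I_k.+1 => x i w)) => //.
- exact: ring_coef_ge0.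
- exact: ring_weight_sum1.
- by move=> i; exact: run_x_dom (runs w) _.
Qed.

Lemma expect_Delta_ring_le0 : E (fun w => Delta_fine (ring w)) <= Delta_fine x0.
Proof.
apply: (@le_trans _ _ (\sum_(i < k.+1) ring_weight n tau k i / total_weight n tau k
   * E (fun w => Delta_fine (x i w)))).
  rewrite (eq_bigr (fun i : 'I_k.+1 => expect q (fun h =>
    ring_weight n tau k i / total_weight n tau k * Delta_fine (x i (rep h))))); last first.
    by move=> i _; rewrite expectZ.
  rewrite -expect_sum le_expect// => h _.
  by have [] := ring_point_jensen (rep h) Delta_fine_convex.
rewrite -[leRHS]mul1r -ring_weight_sum1 mulr_suml; apply: ler_sum => i _.
by rewrite ler_wpM2l ?ring_coef_ge0// expect_Delta_le0// -ltnS.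
Qed.

Variable mu : R.
Hypothesis mu_gt0 : 0 < mu.
Hypothesis strongly_convex : forall u, dom psi u ->
  composite_fine f psi xstar + mu / 2 * wnormsq v (u - xstar)
  <= composite_fine f psi u.

(** The constant turns the left side into [(mu (1 - t0) G + mu / 2 N) / (1 + mu (1 - t0))], and
    strong convexity bounds [mu / 2 N] by [G]. *)
Lemma Delta_fine_le_gap u : dom psi u ->
  mu * t0 ^+ 2 / (1 + mu * (1 - t0)) * Delta_fine u <= gap u.
Proof.
move=> Du; have := strongly_convex Du; rewrite /Delta_fine /gap /Fr.
set G := composite_fine f psi u - _; set N := wnormsq _ _ => sc.
have NG : mu / 2 * N <= G by rewrite /G lerBrDl.
have t1 : t0 <= 1 by case/andP: th0.
have D0 : 0 < 1 + mu * (1 - t0).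
  by rewrite ltr_wpDr// mulr_ge0 ?subr_ge0// ltW.
have -> : mu * t0 ^+ 2 / (1 + mu * (1 - t0)) *
    ((1 - t0) / t0 ^+ 2 * G + (2 * t0 ^+ 2)^-1 * N) =
   (mu * (1 - t0) * G + mu / 2 * N) / (1 + mu * (1 - t0)).
  by field; rewrite !gt_eqF.
rewrite ler_pdivrMr//; lra.
Qed.

(** Jensen with the ring weights bounds the weighted gaps below by [total_weight] times the gap at
    the ring point; [Delta_fine_le_gap] then produces [m_coef]. *)
Lemma expect_Delta_add : (0 < k)%N ->
  E (fun w => Delta_fine (x k w)) + m_coef n tau k mu * E (fun w => Delta_fine (ring w))
  <= Delta_fine x0.
Proof.
move=> k0; have := expect_Delta_le (leqnn k) k0; rewrite lerBrDr.
apply: le_trans; rewrite lerD2l.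
have W0 := total_weight_gt0 th0 k.
apply: (@le_trans _ _ (total_weight n tau k * E (fun w => gap (ring w)))).
  rewrite /m_coef -/t0 /E -!expectZ le_expect// => h _.
  rewrite mulrAC [leRHS]mulrC ler_wpM2r ?(ltW W0)//.
  apply: Delta_fine_le_gap.
  by have [] := ring_point_jensen (rep h) Delta_fine_convex.
rewrite /E -expectZ (eq_bigr (fun i : 'I_k.+1 => expect q (fun h =>
    ring_weight n tau k i * gap (x i (rep h))))); last first.
  by move=> i _; rewrite expectZ.
rewrite -expect_sum le_expect// => h _.
have [_ Fring] := ring_point_jensen (rep h) (composite_convex f_convex psi_gtNy psi_convex).
have H : gap (ring (rep h)) <= \sum_(i < k.+1)
   ring_weight n tau k i / total_weight n tau k * gap (x i (rep h)).
  rewrite /gap; under eq_bigr do rewrite mulrBr.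
  by rewrite sumrB -mulr_suml ring_weight_sum1 mul1r lerD2r.
move: H => /(ler_wpM2l (ltW W0)); rewrite mulr_sumr.
rewrite (eq_bigr (fun i : 'I_k.+1 => ring_weight n tau k i * gap (x i (rep h))))//.
by move=> i _; rewrite mulrA mulrCA divff ?mulr1 ?gt_eqF.
Qed.

End descent.

(** * Assembly of the theorem from the real inequalities *)

(** A subset of ['I_n] has at most [n] elements, so [tau <= n]; together with [tau > 0] this also
    gives [n > 0]. *)
Lemma mean_size_bounds (R : realType) (d : measure_display)
    (T : measurableType d) (P : probability T R) (n : nat) (tau : R)
    (Shat : {RV P >-> {set 'I_n}}) :
  ('E_P[fun w => (#|Shat w|%:R)%R] = tau%:E)%E -> 0 < tau ->
  0 < tau / n%:R <= 1.
Proof.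
move=> tauE tau_gt0.
have tn : tau <= n%:R.
  have -> : n%:R = \sum_A sampling_prob Shat A * n%:R :> R.
    by rewrite -mulr_suml sampling_prob_sum1 mul1r.
  rewrite -(sampling_card tauE).
  apply: ler_sum => A _; rewrite ler_wpM2l ?sampling_prob_ge0//.
  by rewrite ler_nat -[leqRHS](card_ord n) max_card.
have n0 := lt_le_trans tau_gt0 tn.
by rewrite divr_gt0//= ler_pdivrMr// mul1r.
Qed.

Lemma DeltaE (R : realType) (n : nat) (f : 'rV[R]_n -> R)
    (psi : 'I_n -> R -> \bar R) (v : 'I_n -> R) (xstar : 'rV[R]_n) (tau : R) u :
  (forall i t, (-oo < psi i t)%E) -> dom psi xstar -> dom psi u ->
  Delta (composite f psi) xstar (tau / n%:R) v u =
  (Delta_fine f psi v xstar tau u)%:E.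
Proof.
by move=> psi_gtNy Ds Du; rewrite /Delta !compositeE// -EFinB -EFinM -EFinD.
Qed.

Theorem theorem2 (R : realType) (d : measure_display) (T : measurableType d)
    (P : probability T R) (n : nat)
    (f : 'rV[R]_n -> R) (psi : 'I_n -> R -> \bar R) (v : 'I_n -> R)
    (xstar x0 : 'rV[R]_n) (mu tau sigma : R)
    (Shat : {RV P >-> {set 'I_n}}) (S : nat -> {RV P >-> {set 'I_n}})
    (x y z : nat -> T -> 'rV[R]_n) (k : nat)
    (F := composite f psi) (theta0 := tau / n%:R)
    (f_convex : convex_function setT f)
    (f_diff : forall u : 'rV[R]_n, differentiable f u)
    (psi_gtNy : forall i t, (-oo < psi i t)%E)
    (psi_closed : forall i, closed_function (psi i))
    (psi_convex : forall i, extended_convex (psi i))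
    (xstar_min : is_argmin F xstar)
    (v_gt0 : forall i, 0 < v i)
    (mu_gt0 : 0 < mu)
    (F_strongly_convex : forall u : 'rV[R]_n,
      (F xstar + (mu / 2 * wnormsq v (u - xstar))%:E <= F u)%E)
    (Shat_uniform : forall i j : 'I_n,
      P [set w | i \in Shat w] = P [set w | j \in Shat w])
    (tauE : ('E_P[fun w => (#|Shat w|%:R)%R] = tau%:E)%E)
    (tau_gt0 : 0 < tau)
    (f_eso : eso f Shat tau v)
    (S_indep : mutually_independent S)
    (S_distr : forall j, same_distribution (S j) Shat)
    (x0_dom : effective_domain (separable psi) x0)
    (xyz_approx : forall w, approx_run f psi tau v x0
      (fun j => S j w) (fun j => x j w) (fun j => y j w) (fun j => z j w))
    (k_ge1 : (1 <= k)%N)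
    (sigma01 : 0 <= sigma <= 1) :
  (exists c : 'I_k.+1 -> R,
    [/\ forall i, 0 <= c i, \sum_i c i = 1 &
        forall w, ring_point tau k (fun j => x j w) = \sum_i c i *: x i w])
  /\
  (\int[P]_w Delta F xstar theta0 v (bar_point tau sigma k (fun j => x j w))
   <= (Num.max sigma (1 - sigma * m_coef n tau k mu))%:E
      * Delta F xstar theta0 v x0)%E.
Proof.
have th0 := mean_size_bounds tauE tau_gt0.
have fc := convex_functionP f_convex.
have Dx0 : dom psi x0 by exact: separable_dom.
have Dxs : dom psi xstar.
  apply: (@composite_dom _ _ f) => //; apply: le_lt_trans (xstar_min x0) _.
  by rewrite /F compositeE// ltry.
have smin u : dom psi u -> composite_fine f psi xstar <= composite_fine f psi u.
  by move=> Du; have := xstar_min u; rewrite /F !compositeE// lee_fin.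
have sc u : dom psi u -> composite_fine f psi xstar
    + mu / 2 * wnormsq v (u - xstar) <= composite_fine f psi u.
  by move=> Du; have := F_strongly_convex u; rewrite /F !compositeE// -EFinD lee_fin.
have Smem := sampling_mem Shat_uniform tauE.
have exrep (h : {ffun 'I_k -> {set 'I_n}}) : exists w,
    (exists w', history S k w' = h) -> history S k w = h.
  by have [[w hw]|nh] := pselect (exists w, history S k w = h);
    [exists w | exists point].
have [rep repP] := boolp.choice exrep.
pose c i := ring_weight n tau k i / total_weight n tau k.
split.
  exists (fun i => c i); split=> [i||w].
  - exact: ring_coef_ge0.
  - exact: ring_weight_sum1.
  - exact: ring_pointE.
pose ring w := ring_point tau k (fun j => x j w).
pose bar w := bar_point tau sigma k (fun j => x j w).
pose D := Delta_fine f psi v xstar tau.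
have Dring w : dom psi (ring w).
  by have [] := ring_point_jensen k th0 psi_gtNy psi_convex Dx0 xyz_approx w
    (Delta_fine_convex xstar th0 fc psi_gtNy psi_convex v_gt0).
have Dx w : dom psi (x k w) by exact: (run_x_dom th0 psi_gtNy psi_convex Dx0 (xyz_approx w)).
have Dbar w := Delta_fine_convex xstar th0 fc psi_gtNy psi_convex v_gt0
  sigma01 (Dx w) (Dring w).
(* [bar] factors through the history, which is what turns its integral into a finite sum. *)
have barE w : bar w = bar (rep (history S k w)).
  have hw : history S k (rep (history S k w)) = history S k w.
    by apply: repP; exists w.
  have xE : forall i, (i <= k)%N -> x i w = x i (rep (history S k w)).
    move=> i ik; have [] // := runs_determined th0 psi_gtNy psi_convex v_gt0
      Dx0 xyz_approx (j := k) (w := w) (w' := rep (history S k w)) _ ik.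
    move=> j jk; have := congr1 (fun g : {ffun _} => g (Ordinal jk)) hw.
    by rewrite !ffunE.
  rewrite /bar /bar_point !ring_pointE// xE//; congr (_ + _ *: _).
  by apply: eq_bigr => i _; rewrite xE// -ltnS.
rewrite [leLHS](_ : _ = (expect (sampling_prob Shat) (fun h => D (bar (rep h))))%:E);
    last first.
  rewrite -(history_integral S_indep S_distr); apply: eq_integral => w _.
  by rewrite -barE DeltaE//; case: (Dbar w).
rewrite DeltaE// -EFinM lee_fin -/D.
have A1 := expect_Delta_add th0 fc f_diff psi_gtNy psi_convex v_gt0 Smem f_eso
  S_indep S_distr Dxs Dx0 xyz_approx repP mu_gt0 sc k_ge1.
have B1 := expect_Delta_ring_le0 th0 fc f_diff psi_gtNy psi_convex v_gt0 Smem f_eso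
  S_indep S_distr Dxs smin Dx0 xyz_approx repP.
have q1 := sampling_prob_sum1 Shat.
have q0 := sampling_prob_ge0 Shat.
have Dge0 u : dom psi u -> 0 <= D u.
  move=> Du; apply: addr_ge0; apply: mulr_ge0.
  - by rewrite divr_ge0 ?sqr_ge0// subr_ge0; case/andP: th0.
  - by rewrite subr_ge0 smin.
  - by rewrite invr_ge0 mulr_ge0 ?sqr_ge0.
  - exact: wnormsq_ge0.
cbv beta in A1, B1; set A := expect _ _ in A1; set B := expect _ _ in A1 B1.
have B0 : 0 <= B.
  rewrite -[leLHS](expect_cst k q1) le_expect// => h _.
  exact: Dge0 (Dring _).
have barle : expect (sampling_prob Shat) (fun h => D (bar (rep h)))
    <= sigma * A + (1 - sigma) * B.
  rewrite /A /B -!expectZ -expectD le_expect// => h _.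
  by have [] := Dbar (rep h).
apply: le_trans barle _.
have /andP[s0 s1] := sigma01.
set m := m_coef n tau k mu in A1 *.
have D0 := Dge0 _ Dx0.
have A1' := ler_wpM2l s0 A1; rewrite -/(D x0) in A1' B1.
(* Inserting [A <= D x0 - m * B] leaves [sigma * D x0 + (1 - sigma - sigma * m) * B]. If the
   coefficient of [B] is nonpositive, [B >= 0] gives the factor [sigma]; otherwise [B <= D x0] gives
   [1 - sigma * m]. *)
have [h|h] := lerP (1 - sigma - sigma * m) 0.
  apply: (@le_trans _ _ (sigma * D x0)); last by rewrite ler_wpM2r// le_max lexx.
  have := mulr_le0_ge0 h B0; lra.
apply: (@le_trans _ _ ((1 - sigma * m) * D x0)); last first.
  by rewrite ler_wpM2r// le_max lexx orbT.
have := ler_wpM2l (ltW h) B1; lra.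
Qed.
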